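(* Let $\varepsilon>0$, $\alpha\ge 0$, $\tilde c\ge 0$, $c>0$ and $\rho>0$, and let $I_\rho=(0,\rho)\subset\mathbb{R}$. For $\tau>0$ set $$\zeta(\tau):=\frac{\cosh\tau-1}{\sinh\tau-\tau}.$$ Assume that $$\zeta(\rho\sqrt c)\,\sqrt c>\frac{\alpha}{\varepsilon}.$$ Then, for each of the two choices of the sign $\pm$, the system $$\begin{cases} u''\pm\varepsilon v'-cu+\alpha v\ge 0\\ v''-\tilde c\, v\ge 0\end{cases}\qquad\text{in } I_\rho$$ for scalar functions $u,v$ of one real variable does not satisfy the weak Maximum Principle wMP in $I_\rho$.
   Context: A solution of a system of differential inequalities in a bounded open interval $I$ is a pair $(u,v)$ of real functions belonging to $C^2(I)\cap C^0(\overline I)$ satisfying both inequalities at every point of $I$. The system satisfies the weak Maximum Principle (wMP) in $I$ if every solution $(u,v)$ with $u\le 0$ and $v\le 0$ on $\partial I$ satisfies $u\le 0$ and $v\le 0$ in $I$. It does not satisfy wMP in $I$ if there is a solution with $u\le 0$, $v\le 0$ on $\partial I$ for which $u$ or $v$ is positive at some point of $I$. *)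

(* Defs.v *)
From Stdlib Require Import Reals Lra Classical.
From Coquelicot Require Import Coquelicot.
Open Scope R_scope.

(* Throughout, I = (a,b). Functions on the closure [a,b] are represented by
   total functions R -> R; only their values on [a,b] matter, since all the
   derivatives below are taken at interior points. *)

Definition C2_open (a b : R) (f : R -> R) : Prop :=
  forall x, a < x < b ->
    ex_derive f x /\ ex_derive (Derive f) x /\ continuous (Derive_n f 2) x.

(* [continuous_on] is relative to the set, hence one-sided at a and b. *)
Definition C0_closed (a b : R) (f : R -> R) : Prop :=
  continuous_on (fun x => a <= x <= b) f.

(* The inequalities a pair (u,v) is required to satisfy at a point x. *)
Definition diff_system : Type := (R -> R) -> (R -> R) -> R -> Prop.

Definition is_solution (S : diff_system) (a b : R) (u v : R -> R) : Prop :=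
  (C2_open a b u /\ C0_closed a b u) /\
  (C2_open a b v /\ C0_closed a b v) /\
  forall x, a < x < b -> S u v x.

Definition nonpos_on_boundary (a b : R) (f : R -> R) : Prop :=
  f a <= 0 /\ f b <= 0.

Definition wMP (S : diff_system) (a b : R) : Prop :=
  forall u v : R -> R,
    is_solution S a b u v ->
    nonpos_on_boundary a b u -> nonpos_on_boundary a b v ->
    forall x, a < x < b -> u x <= 0 /\ v x <= 0.

Definition fails_wMP (S : diff_system) (a b : R) : Prop :=
  exists u v : R -> R,
    is_solution S a b u v /\
    nonpos_on_boundary a b u /\ nonpos_on_boundary a b v /\
    exists x, a < x < b /\ (0 < u x \/ 0 < v x).

Lemma fails_wMP_iff (S : diff_system) (a b : R) :
  fails_wMP S a b <-> ~ wMP S a b.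
Proof.
split.
- intros (u & v & Hs & Hu & Hv & x & Hx & Hpos) H.
  destruct (H u v Hs Hu Hv x Hx); lra.
- intros H. apply NNPP. intros Hn. apply H.
  intros u v Hs Hu Hv x Hx.
  split; apply Rnot_lt_le; intros Hp; apply Hn; exists u, v;
    repeat (split; try assumption); exists x; tauto.
Qed.

Definition zeta (tau : R) : R := (cosh tau - 1) / (sinh tau - tau).

(* [s] is the sign (1 or -1) in front of [eps * v']. *)
Definition coupled_system (s eps alpha c ct : R) : diff_system :=
  fun u v x =>
    Derive_n u 2 x + s * eps * Derive v x - c * u x + alpha * v x >= 0 /\
    Derive_n v 2 x - ct * v x >= 0.

(* Main.v *)
Require Import Defs.
From Stdlib Require Import Reals Lra.
From Coquelicot Require Import Coquelicot.
Open Scope R_scope.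

(** Any [v <= 0] with [v'' = 0] satisfies the second inequality, whatever
    [ct >= 0] is.  So [v] can be taken affine, with the slope [s] that makes the
    coupling term [s * eps * v'] equal to the constant [eps] and hence most
    helpful to a positive [u]: [v = -t], where [t = rho - x] if [s = 1] and
    [t = x] if [s = -1].  In the variable [t], equality in the first line is the
    two-point problem [w'' - c w = alpha t - eps], [w 0 = w rho = 0], whose
    solution [bump] is explicit.  With [k = sqrt c] one finds
    [c * sinh (k rho) * w' 0
       = eps * k * (cosh (k rho) - 1) - alpha * (sinh (k rho) - k rho)],
    so the assumption on [zeta] says exactly that [w' 0 > 0] ([bump_slope_pos]).
    As [w 0 = 0], the function [w] is then positive just to the right of [0]. *)

Lemma one_lt_cosh (t : R) : t <> 0 -> 1 < cosh t.
Proof.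
intros Ht. unfold cosh.
pose proof (exp_ineq1 t Ht).
pose proof (exp_ineq1 (- t) ltac:(lra)).
lra.
Qed.

Lemma lt_sinh (t : R) : 0 < t -> t < sinh t.
Proof.
intros Ht.
destruct (MVT_cor2 sinh cosh 0 t Ht) as (x & Heq & Hx).
- intros x _. apply derivable_pt_lim_sinh.
- rewrite sinh_0 in Heq.
  pose proof (one_lt_cosh x ltac:(lra)). nra.
Qed.

Lemma pos_right_of_zero (f : R -> R) (l rho : R) :
  is_derive f 0 l -> 0 < l -> f 0 = 0 -> 0 < rho ->
  exists t, 0 < t < rho /\ 0 < f t.
Proof.
intros Hf Hl Hf0 Hrho.
apply is_derive_Reals in Hf.
destruct (Hf l Hl) as [d Hd].
pose proof (cond_pos d).
set (h := Rmin (d / 2) (rho / 2)).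
assert (Hh : 0 < h) by (apply Rmin_pos; lra).
assert (h <= d / 2) by apply Rmin_l.
assert (h <= rho / 2) by apply Rmin_r.
exists h. split; [lra|].
specialize (Hd h ltac:(lra)).
rewrite (Rabs_pos_eq h), Rplus_0_l, Hf0, Rminus_0_r in Hd by lra.
specialize (Hd ltac:(lra)).
apply Rabs_def2 in Hd.
replace (f h) with (f h / h * h) by (field; lra).
apply Rmult_lt_0_compat; lra.
Qed.

Lemma Derive_n_2_unique (f f1 f2 : R -> R) (x : R) :
  (forall x, is_derive f x (f1 x)) -> (forall x, is_derive f1 x (f2 x)) ->
  Derive_n f 2 x = f2 x.
Proof.
intros Hf Hf1. simpl. rewrite (Derive_ext _ f1).
- now apply is_derive_unique.
- intros y. now apply is_derive_unique.
Qed.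

Lemma C2_open_of_is_derive (f f1 f2 : R -> R) (a b : R) :
  (forall x, is_derive f x (f1 x)) -> (forall x, is_derive f1 x (f2 x)) ->
  (forall x, continuous f2 x) -> C2_open a b f.
Proof.
intros Hf Hf1 Hf2 x _. repeat split.
- now exists (f1 x).
- exists (f2 x). apply (is_derive_ext f1); [|easy].
  intros y. symmetry. now apply is_derive_unique.
- apply (continuous_ext f2); [|easy].
  intros y. symmetry. now apply (Derive_n_2_unique f f1).
Qed.

Lemma C0_closed_of_is_derive (f f1 : R -> R) (a b : R) :
  (forall x, is_derive f x (f1 x)) -> C0_closed a b f.
Proof.
intros Hf. apply continuous_on_forall. intros x _.
apply (ex_derive_continuous (V := R_NormedModule)). now exists (f1 x).
Qed.

(** The solution of [w'' - k^2 w = alpha t - eps] with [w 0 = w rho = 0]: a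
    particular affine solution plus the combination of [cosh] and [sinh] that
    corrects its boundary values. *)
Definition sinh_coef (eps alpha k rho : R) : R :=
  (eps * (cosh (k * rho) - 1) + alpha * rho) / (k ^ 2 * sinh (k * rho)).

Definition bump (eps alpha k rho t : R) : R :=
  (eps - alpha * t - eps * cosh (k * t)) / k ^ 2
  + sinh_coef eps alpha k rho * sinh (k * t).

Definition bump' (eps alpha k rho t : R) : R :=
  (- alpha - eps * k * sinh (k * t)) / k ^ 2
  + sinh_coef eps alpha k rho * (k * cosh (k * t)).

Lemma is_derive_bump (eps alpha k rho t : R) : k <> 0 ->
  is_derive (bump eps alpha k rho) t (bump' eps alpha k rho t).
Proof.
intros Hk. unfold bump, bump'. auto_derive; [easy|]. now field.
Qed.

Lemma is_derive_bump' (eps alpha k rho t : R) : k <> 0 ->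
  is_derive (bump' eps alpha k rho) t
    (k ^ 2 * bump eps alpha k rho t + alpha * t - eps).
Proof.
intros Hk. unfold bump, bump'. auto_derive; [easy|]. now field.
Qed.

Lemma bump_0 (eps alpha k rho : R) : k <> 0 -> bump eps alpha k rho 0 = 0.
Proof.
intros Hk. unfold bump. rewrite !Rmult_0_r, cosh_0, sinh_0. now field.
Qed.

Lemma bump_rho (eps alpha k rho : R) : 0 < k -> 0 < rho ->
  bump eps alpha k rho rho = 0.
Proof.
intros Hk Hrho.
assert (0 < k * rho) by now apply Rmult_lt_0_compat.
pose proof (lt_sinh (k * rho) ltac:(lra)).
unfold bump, sinh_coef. field. lra.
Qed.

Lemma bump_slope_pos (eps alpha k rho : R) :
  0 < eps -> 0 < k -> 0 < rho -> alpha / eps < zeta (k * rho) * k ->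
  0 < bump' eps alpha k rho 0.
Proof.
intros Heps Hk Hrho Hzeta.
assert (0 < k * rho) by now apply Rmult_lt_0_compat.
pose proof (lt_sinh (k * rho) ltac:(lra)) as Hsinh.
unfold bump', sinh_coef. rewrite !Rmult_0_r, sinh_0, cosh_0.
(* The slope is a positive multiple of the gap in the assumption on [zeta]. *)
replace (_ + _) with
  (eps * (sinh (k * rho) - k * rho) / (k ^ 2 * sinh (k * rho))
   * (zeta (k * rho) * k - alpha / eps))
  by (unfold zeta; field; lra).
apply Rmult_lt_0_compat; [|lra].
apply Rdiv_lt_0_compat; apply Rmult_lt_0_compat; try lra.
now apply pow_lt.
Qed.

(** The substitution [t = a - s x] treats both signs at once: the second
    derivative and the coupling term [s * v' = s * s] see the sign only through
    [s * s = 1]. *)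
Lemma reflected_bump_is_solution (eps alpha ct k rho s a : R) :
  k <> 0 -> 0 <= ct -> s * s = 1 ->
  (forall x, 0 < x < rho -> 0 <= a - s * x) ->
  is_solution (coupled_system s eps alpha (k ^ 2) ct) 0 rho
    (fun x => bump eps alpha k rho (a - s * x)) (fun x => s * x - a).
Proof.
intros Hk Hct Hs Hpos.
set (w := bump eps alpha k rho).
assert (Hu : forall x, is_derive (fun x => w (a - s * x)) x
                         (- s * bump' eps alpha k rho (a - s * x))).
{ intros x.
  apply (is_derive_comp w (fun x => a - s * x)); [now apply is_derive_bump|].
  auto_derive; [easy|ring]. }
assert (Hu1 : forall x,
  is_derive (fun x => - s * bump' eps alpha k rho (a - s * x)) x
    (k ^ 2 * w (a - s * x) + alpha * (a - s * x) - eps)).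
{ intros x.
  replace (_ - eps) with
    (- s * (- s * (k ^ 2 * w (a - s * x) + alpha * (a - s * x) - eps)))
    by (transitivity (s * s
          * (k ^ 2 * w (a - s * x) + alpha * (a - s * x) - eps));
        [|rewrite Hs]; ring).
  apply is_derive_scal.
  apply (is_derive_comp (bump' eps alpha k rho) (fun x => a - s * x)).
  - now apply is_derive_bump'.
  - auto_derive; [easy|ring]. }
assert (Hv : forall x, is_derive (fun x => s * x - a) x s)
  by (intros x; auto_derive; [easy|ring]).
assert (Hv1 : forall x : R, is_derive (fun _ => s) x 0)
  by (intros x; apply (is_derive_const (K := R_AbsRing) s)).
split; [|split]; [split|split|].
- apply (C2_open_of_is_derive _ _ _ _ _ Hu Hu1). intros x.
  apply (ex_derive_continuous (V := R_NormedModule)).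
  apply (ex_derive_ext
    (fun x => k ^ 2 * w (a - s * x) + (alpha * (a - s * x) - eps)));
    [intros; simpl; ring|].
  apply (ex_derive_plus (V := R_NormedModule)).
  + apply ex_derive_scal. eexists. apply Hu.
  + now auto_derive.
- apply (C0_closed_of_is_derive _ _ _ _ Hu).
- apply (C2_open_of_is_derive _ _ _ _ _ Hv Hv1). intros x. apply continuous_const.
- apply (C0_closed_of_is_derive _ _ _ _ Hv).
- intros x Hx. unfold coupled_system.
  rewrite (Derive_n_2_unique _ _ _ _ Hu Hu1), (Derive_n_2_unique _ _ _ _ Hv Hv1).
  rewrite (is_derive_unique (fun x : R => s * x - a) x s (Hv x)).
  split.
  + apply Req_ge.
    transitivity (eps * (s * s - 1)); [|rewrite Hs]; ring.
  + specialize (Hpos x Hx). nra.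
Qed.

Theorem proposition1 (eps alpha ct c rho : R)
  (Heps : eps > 0) (Halpha : alpha >= 0) (Hct : ct >= 0)
  (Hc : c > 0) (Hrho : rho > 0)
  (Hzeta : zeta (rho * sqrt c) * sqrt c > alpha / eps) :
  forall s : R, s = 1 \/ s = -1 ->
    fails_wMP (coupled_system s eps alpha c ct) 0 rho.
Proof.
intros s Hs.
assert (Hk : 0 < sqrt c) by now apply sqrt_lt_R0.
assert (Hk2 : sqrt c ^ 2 = c) by (apply pow2_sqrt; lra).
set (k := sqrt c) in *. rewrite (Rmult_comm rho k) in Hzeta.
destruct (pos_right_of_zero (bump eps alpha k rho) (bump' eps alpha k rho 0) rho)
  as (t & Ht & Hwt).
{ apply is_derive_bump; lra. }
{ apply bump_slope_pos; lra. }
{ apply bump_0; lra. }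
{ lra. }
pose proof (bump_0 eps alpha k rho ltac:(lra)) as Hw0.
pose proof (bump_rho eps alpha k rho Hk Hrho) as Hwrho.
rewrite <- Hk2.
(* With this [a], [a - s x] is [rho - x] for [s = 1] and [x] for [s = -1]. *)
set (a := (1 + s) / 2 * rho).
exists (fun x => bump eps alpha k rho (a - s * x)), (fun x => s * x - a).
split; [|split; [|split]].
- apply reflected_bump_is_solution; try lra.
  + destruct Hs; subst s; lra.
  + intros x Hx. unfold a. destruct Hs; subst s; lra.
- unfold nonpos_on_boundary, a. destruct Hs; subst s.
  + replace (_ - 1 * 0) with rho by field.
    replace (_ - 1 * rho) with 0 by field. lra.
  + replace (_ - -1 * 0) with 0 by field.
    replace (_ - -1 * rho) with rho by field. lra.
- unfold nonpos_on_boundary, a. destruct Hs; subst s; lra.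
- exists (s * (a - t)). unfold a. split.
  + destruct Hs; subst s; lra.
  + left. replace (_ - s * _) with t; [easy|].
    destruct Hs; subst s; field.
Qed.
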